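(* The limiting densities for 4- and 5-dependent sets in toroidal kings graphs in two dimensions satisfy the bounds \[ \frac{3}{5} \leq \tau^{(2)}_4 \leq 0.608956 \] and \[ \frac{9}{13} \leq \tau^{(2)}_5 \leq 0.693943. \]
   Context: For an integer $n\ge 2$, the toroidal kings graph $T[n,n]$ has vertex set $\{1,\ldots,n\}^2$, with coordinates read modulo $n$; distinct vertices $v=(v_1,v_2)$ and $u=(u_1,u_2)$ are neighbors if and only if $v_i-u_i\equiv -1,0$ or $1 \pmod n$ for $i=1,2$. (When $n=2$ neighbors are counted with multiplicity, the number of neighbors of $v$ in $S$ being the number of nonzero $y\in\{-1,0,1\}^2$ with $v+y\in S$.) A set $S$ of vertices is $k$-dependent if each vertex of $S$ has at most $k$ neighbors in $S$. Let $\beta_k(T[n,n])$ be the maximum cardinality of a $k$-dependent set in $T[n,n]$, let $\tau^{(2)}_k(n)=\beta_k(T[n,n])/n^2$, and let $\tau^{(2)}_k=\lim_{n\to\infty}\tau^{(2)}_k(n)$ (this limit exists). *)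

(* Defs.v *)
(* MathComp / MathComp-Analysis *)
From HB Require Import structures.
From mathcomp Require Import all_boot all_order all_algebra zify.
From mathcomp Require Import all_classical all_reals all_analysis.

Set Implicit Arguments.
Unset Strict Implicit.
Unset Printing Implicit Defensive.

Import Order.TTheory GRing.Theory Num.Theory.
Import numFieldNormedType.Exports.

Local Open Scope ring_scope.

Definition steps : seq int := [:: -1; 0; 1].

Definition king_moves : seq (int * int) :=
  [seq y <- [seq (a, b) | a <- steps, b <- steps] | y != (0, 0)].

(* The coordinate i + d read modulo n, as a representative in 0, ..., n - 1.
   The default i of insubd is never used: see cyc_addE. *)
Definition cyc_add (n : nat) (i : 'I_n) (d : int) : 'I_n :=
  insubd i `|((i%:Z + d) %% n%:Z)%Z|%N.

Definition torus_add (n : nat) (v : 'I_n * 'I_n) (y : int * int) :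
    'I_n * 'I_n :=
  (cyc_add v.1 y.1, cyc_add v.2 y.2).

Definition cyc_near (n : nat) (i j : 'I_n) : bool :=
  has (fun d => (i%:Z - j%:Z == d %[mod n%:Z])%Z) steps.

Definition kings_adj (n : nat) (v u : 'I_n * 'I_n) : bool :=
  [&& v != u, cyc_near v.1 u.1 & cyc_near v.2 u.2].

(* Neighbors are counted by moves, which gives the multiplicities wanted when
   n = 2; for n >= 3 this is the number of u in S adjacent to v: see
   nbr_countE. *)
Definition nbr_count (n : nat) (S : {set 'I_n * 'I_n}) (v : 'I_n * 'I_n) : nat :=
  count (fun y => torus_add v y \in S) king_moves.

Definition dependent_set (k n : nat) (S : {set 'I_n * 'I_n}) : bool :=
  [forall v in S, (nbr_count S v <= k)%N].

Definition kings_beta (k n : nat) : nat :=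
  \max_(S : {set 'I_n * 'I_n} | dependent_set k S) #|S|.

(* Only n >= 2 is meaningful; the values at 0 and 1 do not affect the limit. *)
Definition kings_density (R : realType) (k n : nat) : R :=
  (kings_beta k n)%:R / n%:R ^+ 2.

Definition kings_tau (R : realType) (k : nat) : R :=
  limn (kings_density R k).

Lemma cyc_addE (n : nat) (i : 'I_n) (d : int) :
  (cyc_add i d)%:Z = ((i%:Z + d) %% n%:Z)%Z.
Proof.
have n0 : (0 < n)%N by case: i => i /=; lia.
have nz : n%:Z != 0 by lia.
have ge0 := modz_ge0 (i%:Z + d) nz.
have n0z : 0 < n%:Z by lia.
have ltn := ltz_pmod (i%:Z + d) n0z.
rewrite /cyc_add val_insubd.
have -> : (`|((i%:Z + d) %% n%:Z)%Z| < n)%N by lia.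
lia.
Qed.

Lemma cyc_add_eq (n : nat) (i j : 'I_n) (d : int) :
  (cyc_add i d == j) = (j%:Z - i%:Z == d %[mod n%:Z])%Z.
Proof.
rewrite -val_eqE /= -eqz_nat cyc_addE.
have jE : (j%:Z = j%:Z %% n%:Z)%Z.
  by rewrite modz_small //; have := ltn_ord j; lia.
by rewrite [in LHS]jE eq_sym !eqz_mod_dvd opprD addrA.
Qed.

Lemma cyc_nearE (n : nat) (i j : 'I_n) :
  cyc_near i j = has (fun d => cyc_add i d == j) steps.
Proof.
rewrite /cyc_near /= !cyc_add_eq !eqz_mod_dvd !orbF.
have e d : (n%:Z %| j%:Z - i%:Z - d)%Z = (n%:Z %| i%:Z - j%:Z - - d)%Z.
  have -> : i%:Z - j%:Z - - d = - (j%:Z - i%:Z - d) by lia.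
  by rewrite !dvdzE abszN.
by rewrite !e opprK oppr0 orbCA orbA orbC.
Qed.

Lemma cyc_add_inj (n : nat) (i : 'I_n) : (2 < n)%N ->
  {in steps &, injective (cyc_add i)}.
Proof.
move=> n2 a b; rewrite !inE => ha hb /(congr1 (fun x : 'I_n => (x : nat)%:Z)).
rewrite !cyc_addE => /eqP; rewrite eqz_mod_dvd => nd; apply/eqP.
rewrite -subr_eq0; apply: contraLR nd => ab0.
have -> : i%:Z + a - (i%:Z + b) = a - b by lia.
rewrite dvdzE /= gtnNdvd //; first by rewrite absz_gt0.
by case/or3P: ha => /eqP ->; case/or3P: hb => /eqP ->; lia.
Qed.

Lemma cyc_add0 (n : nat) (i : 'I_n) : cyc_add i 0 = i.
Proof. by apply/eqP; rewrite cyc_add_eq subrr. Qed.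

Lemma nbr_countE (n : nat) (S : {set 'I_n * 'I_n}) (v : 'I_n * 'I_n) :
  (2 < n)%N -> nbr_count S v = #|[set u in S | kings_adj v u]|.
Proof.
move=> n2.
have memk y : y \in king_moves -> (y.1 \in steps) && (y.2 \in steps).
  rewrite mem_filter => /andP[_ /allpairsP[[a b] /= [ha hb ->]]] /=.
  by rewrite ha hb.
have inj : {in king_moves &, injective (torus_add v)}.
  move=> [a b] [c d] /memk/andP[/= ha hb] /memk/andP[/= hc hd] [] e1 e2.
  by rewrite (cyc_add_inj n2 ha hc e1) (cyc_add_inj n2 hb hd e2).
have un : uniq (map (torus_add v) king_moves) by rewrite map_inj_in_uniq.
rewrite /nbr_count -(count_map (torus_add v) (mem S)) -size_filter.
rewrite -(card_uniqP (filter_uniq _ un)); apply: eq_card => u.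
rewrite mem_filter [RHS]inE; congr (_ && _); rewrite /kings_adj !cyc_nearE.
apply/mapP/and3P => [[y hy ->]|[vu /hasP[a ha /eqP ea] /hasP[b hb /eqP eb]]].
  have /andP[h1 h2] := memk _ hy.
  split; [|by apply/hasP; exists y.1|by apply/hasP; exists y.2].
  move: hy; rewrite mem_filter => /andP[y0 _].
  apply: contra y0; case: y h1 h2 => a b /= h1 h2.
  rewrite {1}[v]surjective_pairing xpair_eqE -{1}(cyc_add0 v.1).
  rewrite -{1}(cyc_add0 v.2) => /andP[/eqP e1 /eqP e2].
  by rewrite -(cyc_add_inj n2 _ h1 e1) // -(cyc_add_inj n2 _ h2 e2).
exists (a, b); last by rewrite /torus_add /= ea eb; case: (u).
rewrite mem_filter; apply/andP; split; last by apply/allpairsP; exists (a, b).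
apply: contra vu => /eqP[a0 b0]; apply/eqP.
by rewrite [v]surjective_pairing [u]surjective_pairing -ea -eb a0 b0 !cyc_add0.
Qed.

(* Main.v *)
Require Import Defs.
From mathcomp Require Import all_boot all_order all_algebra zify ssrZ ring lra.
From mathcomp Require Import all_classical all_reals all_analysis.

Set Implicit Arguments.
Unset Strict Implicit.
Unset Printing Implicit Defensive.

Import Order.TTheory GRing.Theory Num.Theory.
Import numFieldNormedType.Exports.

Local Open Scope ring_scope.

(* Binary integers, for the evaluation of the certificates. *)
Local Notation Z := BinNums.Z.

(** Upper bounds. Read the indicator function of a k-dependent set S through
    the 4 x 4 window placed at each vertex v. For a set F of cells of the
    window, the number of positions v at which S contains the copy v + F does
    not change when F is translated. Hence, summed over all v, the difference of
    the monomials x^F and x^G (x^F being 1 if S fills F, and 0 otherwise)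
    vanishes when G is a translate of F; it also vanishes when G is a translate
    of a rotated or reflected copy of F, once both monomials are averaged over
    the symmetries of the square. Adding multiples of such differences to
    w * (number of points of S in the window) gives a function of the window
    whose sum over v is still 16 w |S|, but whose values are much more even. If
    it is at most B on those of the 2^16 patterns in which none of the four inner
    cells has more than k neighbors, then 16 w |S| <= B n^2, that is, the
    density is at most B / (16 w) (certificate_bound).

    Finding the best multipliers is the dual of the linear program that
    maximizes the density over probability distributions on such patterns whose
    marginals agree on congruent sets of cells. Sets F of at most three cells
    suffice, and exchanges4 and exchanges5 are integral solutions, giving
    1948 / 3200 = 0.60875 and 2242 / 3232 = 0.6936... . The maximum over the
    2^16 patterns is found by evaluation: the function is a multilinear
    polynomial, stored as a binary tree, whose values are obtained by fixing one
    variable after the other.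

    Existence of the limit. A k-dependent set of T[N,N] unrolls to a periodic
    set of the plane. Its restriction to n x n cells, with the last row and
    column emptied, is k-dependent in T[n,n] and contains about (n / N)^2 copies
    of the original set. So the density at N exceeds the density at n by
    at most 2 N / n (kings_density_compare), which forces the densities to
    converge to their supremum (kings_density_cvg). The supremum inherits every
    upper bound valid for all n, and lies above each single density.

    Lower bounds. By the preceding remark, one set in T[5,5] and one in T[13,13]
    are enough: the sets where i + 2j mod 5, respectively i + 5j mod 13, lies in
    a fixed set of 3, respectively 9, residues. *)

(** * Translations of the torus *)

Lemma cyc_addA (n : nat) (i : 'I_n) (a b : int) :
  cyc_add (cyc_add i a) b = cyc_add i (a + b).
Proof.
apply/val_inj/eqP; rewrite -eqz_nat; apply/eqP.
by rewrite !cyc_addE modzDml addrA.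
Qed.

Lemma torus_addA (n : nat) (v : 'I_n * 'I_n) (y z : int * int) :
  torus_add (torus_add v y) z = torus_add v (y + z).
Proof. by rewrite /torus_add !cyc_addA. Qed.

Lemma torus_add0 (n : nat) (v : 'I_n * 'I_n) : torus_add v 0 = v.
Proof. by rewrite /torus_add !cyc_add0; case: v. Qed.

Lemma torus_add_bij (n : nat) (t : int * int) :
  bijective (fun v : 'I_n * 'I_n => torus_add v t).
Proof.
exists (fun v => torus_add v (- t)) => v /=.
  by rewrite torus_addA subrr torus_add0.
by rewrite torus_addA addNr torus_add0.
Qed.

Definition occurrences (n : nat) (S : {set 'I_n * 'I_n}) (F : seq (int * int)) :
    nat :=
  \sum_v all (fun y => torus_add v y \in S) F.

Lemma occurrences_perm (n : nat) (S : {set 'I_n * 'I_n}) F G :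
  perm_eq F G -> occurrences S F = occurrences S G.
Proof. by move=> FG; apply: eq_bigr => v _; rewrite (perm_all _ FG). Qed.

Lemma occurrences_shift (n : nat) (S : {set 'I_n * 'I_n}) F t :
  occurrences S [seq y + t | y <- F] = occurrences S F.
Proof.
rewrite [RHS](reindex _ (onW_bij _ (torus_add_bij n t))).
apply: eq_bigr => v _; rewrite all_map; congr (nat_of_bool _).
by apply: eq_all => y /=; rewrite torus_addA addrC.
Qed.

Lemma occurrences1 (n : nat) (S : {set 'I_n * 'I_n}) y :
  occurrences S [:: y] = #|S|.
Proof.
rewrite -[y]add0r -[[:: _]]/[seq z + y | z <- [:: 0]] occurrences_shift.
rewrite -sum1_card [RHS]big_mkcond; apply: eq_bigr => v _ /=.
by rewrite torus_add0 andbT; case: ifP.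
Qed.

Definition le_lex (y z : int * int) : bool :=
  (y.1 < z.1) || (y.1 == z.1) && (y.2 <= z.2).

Definition least_coords (F : seq (int * int)) : int * int :=
  (foldr Num.min (head 0 F).1 (unzip1 F), foldr Num.min (head 0 F).2 (unzip2 F)).

(** A translate of F listed in a fixed order, so that two cell lists are
    translates of each other when their normal forms are equal. *)
Definition normal_form (F : seq (int * int)) : seq (int * int) :=
  sort le_lex [seq y - least_coords F | y <- F].

Lemma occurrences_normal_form (n : nat) (S : {set 'I_n * 'I_n}) F :
  occurrences S (normal_form F) = occurrences S F.
Proof.
rewrite (@occurrences_perm _ _ _ [seq y - least_coords F | y <- F]).
  exact: occurrences_shift.
by rewrite perm_sort.
Qed.

(** * Windows *)

(** The cells of the window are numbered row by row:
<<
     0  1  2  3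
     4  5  6  7
     8  9 10 11
    12 13 14 15
>> *)
Definition cell (c : nat) : int * int := ((c %/ 4)%N : int, (c %% 4)%N : int).

Definition window (n : nat) (S : {set 'I_n * 'I_n}) (v : 'I_n * 'I_n) :
    nat -> bool :=
  fun c => torus_add v (cell c) \in S.

Definition transpose (c : nat) : nat := (4 * (c %% 4) + c %/ 4)%N.
Definition mirror (c : nat) : nat := (4 * (c %/ 4) + (3 - c %% 4))%N.

Definition symmetries : seq (nat -> nat) :=
  let r c := mirror (transpose c) in
  [:: id; r; r \o r; r \o r \o r;
      mirror; mirror \o r; mirror \o r \o r; mirror \o r \o r \o r].

Definition images (F : seq nat) : seq (seq nat) :=
  [seq map g F | g <- symmetries].

Definition same_shape (F G : seq nat) : bool :=
  perm_eq [seq normal_form (map cell H) | H <- images F]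
          [seq normal_form (map cell H) | H <- images G].

(** Congruent sets of cells occur equally often in S once their eight images
    are counted together: S itself need not be symmetric, so one image alone
    would not do. *)
Lemma sum_occurrences_images (n : nat) (S : {set 'I_n * 'I_n}) F G :
  same_shape F G ->
  (\sum_(H <- images F) occurrences S (map cell H) =
   \sum_(H <- images G) occurrences S (map cell H))%N.
Proof.
have E K : (\sum_(H <- images K) occurrences S (map cell H) =
   \sum_(L <- [seq normal_form (map cell H) | H <- images K]) occurrences S L)%N.
  by rewrite big_map; apply: eq_bigr => H _; rewrite occurrences_normal_form.
by move=> FG; rewrite !E; apply: perm_big.
Qed.

(** A line (a, F, G) of a certificate stands for a * (x^F - x^G), summed over the
    symmetries of the window. *)
Definition exchange : Type := (nat * seq nat * seq nat)%type.

Definition window_value (w : nat) (ex : seq exchange) (x : nat -> bool) : Z :=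
  \sum_(c <- iota 0 16) w%:R *+ x c +
  \sum_(e <- ex)
    (\sum_(H <- images e.1.2) e.1.1%:R *+ all x H -
     \sum_(H <- images e.2) e.1.1%:R *+ all x H).

(** The exchanges cancel in the sum over all positions of the window, and each
    of the 16 cells of the window sees every point of S once. *)
Lemma sum_window_value (n w : nat) (ex : seq exchange) (S : {set 'I_n * 'I_n}) :
  all (fun e => same_shape e.1.2 e.2) ex ->
  \sum_v window_value w ex (window S v) = (w * 16 * #|S|)%:R.
Proof.
move=> exok; rewrite big_split /= exchange_big /=.
have mon (c : nat) H :
    \sum_v c%:R *+ all (window S v) H = (c * occurrences S (map cell H))%:R :> Z.
  rewrite natrM /occurrences natr_sum big_distrr /=; apply: eq_bigr => v _.
  by rewrite all_map mulr_natr.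
have -> : \sum_(c <- iota 0 16) \sum_v w%:R *+ window S v c =
          (w * 16 * #|S|)%:R :> Z.
  under eq_bigr => c _.
    under eq_bigr => v _ do
      rewrite -[window S v c]andbT -[_ && _]/(all (window S v) [:: c]).
    rewrite mon occurrences1; over.
  by rewrite big_const_seq count_predT size_iota iter_addr_0 -mulrnA; congr _%:R; lia.
rewrite exchange_big big1_seq ?addr0 //= => e /(allP exok) /= eFG.
rewrite sumrB exchange_big [X in _ - X]exchange_big /=.
under eq_bigr do rewrite mon.
under [X in _ - X]eq_bigr do rewrite mon.
by rewrite -!natr_sum -!big_distrr /= (sum_occurrences_images _ eFG) subrr.
Qed.

(** The four 3 x 3 squares of the window start at the cells 0, 1, 4 and 5. The
    center of the square that starts at c is c + 5. *)
Definition square_corners : seq nat := [:: 0; 1; 4; 5]%N.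
Definition ring_cells : seq nat := [:: 0; 1; 2; 4; 6; 8; 9; 10]%N.

Definition crowded (k : nat) (x : nat -> bool) : bool :=
  has (fun c => x (c + 5)%N && (k < count (fun d => x (c + d)%N) ring_cells)%N)
      square_corners.

(** The torus counts neighbors by moves, with multiplicity, and so does the
    window; the two counts agree even if it wraps around onto itself. *)
Lemma window_not_crowded (k n : nat) (S : {set 'I_n * 'I_n}) v :
  dependent_set k S -> ~~ crowded k (window S v).
Proof.
move=> /forallP dS; apply/hasPn => c cc; rewrite negb_and -implybE -leqNgt.
apply/implyP => xc.
have /implyP /(_ xc) := dS (torus_add v (cell (c + 5))).
rewrite /nbr_count; congr (_ <= _)%N.
have -> : count (fun d => window S v (c + d)%N) ring_cells =
          count (fun y => torus_add v y \in S) [seq cell (c + d) | d <- ring_cells].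
  by rewrite count_map.
have -> : [seq cell (c + d) | d <- ring_cells] =
          [seq cell (c + 5) + y | y <- king_moves].
  by move: cc; rewrite !inE => /or4P[] /eqP->.
by rewrite count_map; apply: eq_count => y; rewrite /= torus_addA.
Qed.

(** * Multilinear polynomials *)

(** Split p0 p1 is p0 + x p1, where x is the next variable, on which p0 and p1 do
    not depend. A constant may stand at any depth, which keeps the trees of
    sparse polynomials small. *)
Inductive mlpoly := Const of Z | Split of mlpoly & mlpoly.

Fixpoint mleval (p : mlpoly) (xs : seq bool) : Z :=
  match p with
  | Const a => a
  | Split p0 p1 => mleval p0 (behead xs) +
      (if head false xs then mleval p1 (behead xs) else 0)
  end.

Fixpoint mladd_const (a : Z) (p : mlpoly) : mlpoly :=
  match p with
  | Const b => Const (a + b)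
  | Split p0 p1 => Split (mladd_const a p0) p1
  end.

Fixpoint mladd (p q : mlpoly) : mlpoly :=
  match p, q with
  | Const a, _ => mladd_const a q
  | _, Const b => mladd_const b p
  | Split p0 p1, Split q0 q1 => Split (mladd p0 q0) (mladd p1 q1)
  end.

Fixpoint monomial (a : Z) (bs : seq bool) : mlpoly :=
  match bs with
  | [::] => Const a
  | b :: bs' =>
      if b then Split (Const 0) (monomial a bs') else Split (monomial a bs') (Const 0)
  end.

Lemma mleval_add_const a p xs : mleval (mladd_const a p) xs = a + mleval p xs.
Proof. by elim: p xs => //= p0 IH p1 _ xs; rewrite IH addrA. Qed.

Lemma mleval_add p q xs : mleval (mladd p q) xs = mleval p xs + mleval q xs.
Proof.
elim: p q xs => [a|p0 IH0 p1 IH1] [b|q0 q1] xs; rewrite ?mleval_add_const //.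
  by rewrite addrC.
rewrite /= IH0 IH1 addrACA; congr (_ + _).
by case: (head false xs); rewrite ?addr0.
Qed.

Lemma mleval_monomial a (T : Type) (b x : T -> bool) (s : seq T) :
  mleval (monomial a (map b s)) (map x s) =
  a *+ all (fun i => b i ==> x i) s.
Proof.
elim: s => //= i s IH; case: (b i) => /=.
  by case: (x i); rewrite ?add0r //= IH.
by case: (x i); rewrite IH ?addr0.
Qed.

(** Setting the next variable to 0 or 1 turns Split p0 p1 into p0 or p0 + p1. The
    tree shrinks as variables are fixed, so visiting all patterns costs far less
    than evaluating the polynomial at each of them. The values already
    fixed are kept in read, last one first, as bad needs the whole pattern. *)
Fixpoint bounded (bad : seq bool -> bool) (B : Z) (n : nat) (read : seq bool)
    (p : mlpoly) : bool :=
  match n with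
  | 0 => (mleval p [::] <= B) || bad (rev read)
  | n'.+1 =>
      let: (p0, p1) := if p is Split p0 p1 then (p0, mladd p0 p1) else (p, p) in
      bounded bad B n' (false :: read) p0 && bounded bad B n' (true :: read) p1
  end.

Lemma boundedP bad B n read p xs :
  bounded bad B n read p -> size xs = n ->
  (mleval p xs <= B) || bad (catrev read xs).
Proof.
elim: n read p xs => [|n IH] read p [|x xs] //= ok [sz].
case: p ok => [a|p0 p1] /= /andP[ok0 ok1].
  by case: x; [have := IH _ _ _ ok1 sz | have := IH _ _ _ ok0 sz].
case: x; first by have := IH _ _ _ ok1 sz; rewrite mleval_add.
by have := IH _ _ _ ok0 sz; rewrite addr0.
Qed.

(** * Certificates *)

Definition cell_monomial (a : Z) (F : seq nat) : mlpoly :=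
  monomial a [seq i \in F | i <- iota 0 16].

Definition window_poly (w : nat) (ex : seq exchange) : mlpoly :=
  foldr mladd (Const 0)
    ([seq cell_monomial w%:R [:: c] | c <- iota 0 16] ++
     flatten [seq [seq cell_monomial e.1.1%:R H | H <- images e.1.2] ++
                  [seq cell_monomial (- e.1.1%:R) H | H <- images e.2] | e <- ex]).

Definition certificate_ok (k w B : nat) (ex : seq exchange) : bool :=
  [&& all (fun e => same_shape e.1.2 e.2) ex,
      all (fun e => all (all (gtn 16)) (images e.1.2 ++ images e.2)) ex &
      bounded (fun xs => crowded k (nth false xs)) B%:R 16 [::] (window_poly w ex)].

Lemma mleval_sum ps xs :
  mleval (foldr mladd (Const 0) ps) xs = \sum_(p <- ps) mleval p xs.
Proof.
by elim: ps => [|p ps IH] /=; rewrite ?big_nil // big_cons mleval_add IH.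
Qed.

Lemma mleval_cell_monomial a F x :
  all (gtn 16) F ->
  mleval (cell_monomial a F) [seq x i | i <- iota 0 16] = a *+ all x F.
Proof.
move=> F16; rewrite mleval_monomial; congr (_ *+ nat_of_bool _).
apply/allP/allP => h i iF.
  have i16 : i \in iota 0 16 by rewrite mem_iota; have := allP F16 i iF.
  exact: (implyP (h i i16)).
by apply/implyP => /h.
Qed.

Lemma mleval_window_poly w ex x :
  all (fun e => all (all (gtn 16)) (images e.1.2 ++ images e.2)) ex ->
  mleval (window_poly w ex) [seq x i | i <- iota 0 16] = window_value w ex x.
Proof.
move=> ex16; rewrite mleval_sum big_cat big_map; congr (_ + _).
  rewrite !big_seq; apply: eq_bigr => c; rewrite mem_iota => c16.
  by rewrite mleval_cell_monomial /= ?andbT.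
rewrite big_flatten big_map !big_seq; apply: eq_bigr => e /(allP ex16).
rewrite all_cat => /andP[F16 G16].
rewrite big_cat !(big_map (cell_monomial _)) -sumrN; congr (_ + _); rewrite !big_seq.
  by apply: eq_bigr => H /(allP F16); apply: mleval_cell_monomial.
apply: eq_bigr => H /(allP G16) H16.
by rewrite mleval_cell_monomial // mulNrn.
Qed.

Lemma window_value_le k w B ex x :
  certificate_ok k w B ex -> ~~ crowded k x -> window_value w ex x <= B%:R.
Proof.
case/and3P=> _ ex16 ok ncr; rewrite -mleval_window_poly //.
have := boundedP (xs := [seq x i | i <- iota 0 16]) ok erefl.
rewrite /= -[crowded _ _]/(crowded k x) (negbTE ncr) orbF.
exact.
Qed.

(** Weak duality: a function of the window that is at most B at every position
    has sum at most B n^2, and its sum is 16 w |S|. *)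
Lemma certificate_bound (k w B n : nat) (ex : seq exchange)
    (S : {set 'I_n * 'I_n}) :
  certificate_ok k w B ex -> dependent_set k S ->
  (w * 16 * #|S| <= B * n ^ 2)%N.
Proof.
move=> cok dS; have /and3P[exok _ _] := cok.
rewrite -(ler_nat Z) -(sum_window_value w S exok).
apply: (@le_trans _ _ (\sum_(v : 'I_n * 'I_n) B%:R)).
  by apply: ler_sum => v _; apply: (window_value_le cok); apply: window_not_crowded.
by rewrite sumr_const card_prod card_ord -mulrnA mulnn.
Qed.

Lemma kings_beta_le (k w B n : nat) (ex : seq exchange) :
  certificate_ok k w B ex -> (w * 16 * kings_beta k n <= B * n ^ 2)%N.
Proof.
move=> cok; rewrite /kings_beta.
elim/big_ind: _ => [|a b ha hb|S]; rewrite ?muln0 //.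
  by rewrite /maxn; case: ifP.
exact: (certificate_bound cok).
Qed.

(** The two solutions below come from the linear program described at the top,
    solved with a bound slightly above its optimum in exchange for few
    lines, and then rounded. The weights w = 200 and w = 202 are the scales at
    which the rounded coefficients become integers; the slack lost in
    rounding is less than what the bounds 0.608956 and 0.693943 leave. *)
Definition exchanges4 : seq exchange :=
  [:: (35, [:: 0; 5], [:: 6; 9]);
      (6, [:: 3; 6; 8], [:: 3; 5; 8]);
      (32, [:: 5], [:: 0]);
      (34, [:: 2; 6; 9], [:: 1; 2; 4]);
      (20, [:: 2; 8; 10], [:: 0; 2; 8]);
      (14, [:: 3; 6; 9], [:: 2; 5; 8]);
      (8, [:: 0; 3; 8], [:: 0; 8; 11]);
      (72, [:: 1; 3; 4], [:: 5; 7; 8]);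
      (64, [:: 5; 7; 8], [:: 3; 4; 6]);
      (104, [:: 3; 4; 9], [:: 2; 7; 8]);
      (57, [:: 2; 8], [:: 3; 9]);
      (46, [:: 1; 6; 9], [:: 1; 4; 6]);
      (38, [:: 7; 8], [:: 3; 4]);
      (24, [:: 5; 7; 9], [:: 0; 2; 4]);
      (58, [:: 3; 5; 9], [:: 2; 3; 9]);
      (1, [:: 2; 7; 9], [:: 0; 6; 9]);
      (16, [:: 2; 3; 4], [:: 6; 7; 8]);
      (4, [:: 6; 7; 8], [:: 3; 4; 5]);
      (4, [:: 1; 7; 8], [:: 0; 7; 9]);
      (17, [:: 5; 6; 9], [:: 0; 1; 4]);
      (12, [:: 5; 6; 9], [:: 1; 4; 5])]%N.

Definition exchanges5 : seq exchange :=
  [:: (22, [:: 0; 1; 2], [:: 4; 5; 6]);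
      (22, [:: 3; 5; 8], [:: 3; 6; 8]);
      (50, [:: 1; 7; 9], [:: 0; 6; 8]);
      (42, [:: 5], [:: 0]);
      (20, [:: 1; 2; 4], [:: 2; 6; 9]);
      (120, [:: 2; 3; 5], [:: 2; 6; 9]);
      (120, [:: 2; 6; 9], [:: 2; 4; 5]);
      (5, [:: 2; 8; 10], [:: 0; 2; 8]);
      (26, [:: 5; 6], [:: 1; 2]);
      (17, [:: 3; 6; 9], [:: 2; 5; 8]);
      (46, [:: 1; 3; 4], [:: 5; 7; 8]);
      (70, [:: 3; 4; 9], [:: 2; 7; 8]);
      (65, [:: 2; 8], [:: 3; 9]);
      (68, [:: 0; 2; 5], [:: 1; 6; 9]);
      (100, [:: 1; 6; 9], [:: 1; 4; 6]);
      (6, [:: 5; 7; 9], [:: 1; 3; 5]);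
      (30, [:: 5; 7; 9], [:: 0; 4; 6]);
      (38, [:: 2; 4; 6], [:: 5; 7; 9]);
      (50, [:: 5; 7; 9], [:: 4; 6; 8]);
      (24, [:: 0; 3; 4], [:: 4; 7; 8]);
      (52, [:: 4; 7; 8], [:: 0; 4; 7]);
      (10, [:: 1; 2; 8], [:: 3; 5; 9]);
      (24, [:: 2; 6; 8], [:: 3; 5; 9]);
      (62, [:: 3; 5; 9], [:: 2; 3; 9]);
      (1, [:: 2; 7; 9], [:: 0; 6; 9]);
      (50, [:: 3; 4; 8], [:: 3; 7; 8]);
      (68, [:: 6; 7; 8], [:: 3; 4; 5]);
      (20, [:: 4; 5; 7], [:: 0; 1; 3]);
      (16, [:: 1; 7; 8], [:: 0; 7; 9]);
      (13, [:: 0; 1; 4], [:: 5; 6; 9]);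
      (68, [:: 3; 8; 9], [:: 2; 3; 8])]%N.

Lemma certificate4_ok : certificate_ok 4 200 1948 exchanges4.
Proof. by vm_compute. Qed.

Lemma certificate5_ok : certificate_ok 5 202 2242 exchanges5.
Proof. by vm_compute. Qed.

(** * Extremal sets *)

Lemma kings_beta_max (k n : nat) (S : {set 'I_n * 'I_n}) :
  dependent_set k S -> (#|S| <= kings_beta k n)%N.
Proof. by move=> dS; apply: (leq_bigmax_cond _ dS). Qed.

Lemma kings_beta_attained (k n : nat) :
  exists2 S : {set 'I_n * 'I_n}, dependent_set k S & #|S| = kings_beta k n.
Proof.
have pos : (0 < #|[pred S : {set 'I_n * 'I_n} | dependent_set k S]|)%N.
  apply/card_gt0P; exists finset.set0; rewrite inE; apply/forallP => v.
  by rewrite inE.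
have [S dS bS] := eq_bigmax_cond (fun S : {set 'I_n * 'I_n} => #|S|) pos.
by exists S => //; rewrite -bS.
Qed.

(** * Convergence of the densities *)

Definition wrap (n N : nat) (i : 'I_n) : 'I_N.+1 := inord (i %% N.+1).

Lemma wrapE (n N : nat) (i : 'I_n) : wrap N i = (i %% N.+1)%N :> nat.
Proof. by rewrite inordK // ltn_mod. Qed.

(** The excluded last coordinate n - 1 is the only place where a king move can
    wrap around modulo n, so that away from it reduction modulo N.+1 commutes
    with king moves. *)
Lemma wrap_cyc_add (n N : nat) (i : 'I_n) (d : int) :
  d \in steps -> (i.+1 < n)%N -> ((cyc_add i d).+1 < n)%N ->
  wrap N (cyc_add i d) = cyc_add (wrap N i) d.
Proof.
move=> ds i_n; have n0 : n%:Z != 0 by lia.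
have E : ((cyc_add i d).+1 < n)%N -> (cyc_add i d)%:Z = i%:Z + d.
  have := cyc_addE i d; have [lo|hi] := ltrP (i%:Z + d) 0.
    have -> : i%:Z + d = -1 by move: ds lo; rewrite !inE => /or3P[]/eqP->; lia.
    rewrite -(modzDr (-1) n%:Z) modz_small; lia.
  by rewrite modz_small => [->//|]; move: ds hi; rewrite !inE => /or3P[]/eqP->; lia.
move=> /E {}E; apply/val_inj/eqP; rewrite -eqz_nat; apply/eqP.
by rewrite cyc_addE [\val _]wrapE wrapE -!modz_nat E modzDml.
Qed.

Definition periodic_set (n N : nat) (S : {set 'I_N.+1 * 'I_N.+1}) :
    {set 'I_n * 'I_n} :=
  [set u : 'I_n * 'I_n |
    [&& (u.1.+1 < n)%N, (u.2.+1 < n)%N & (wrap N u.1, wrap N u.2) \in S]].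

Lemma periodic_set_dependent (k n N : nat) (S : {set 'I_N.+1 * 'I_N.+1}) :
  dependent_set k S -> dependent_set k (periodic_set n S).
Proof.
move=> /forallP dS; apply/forallP => u; apply/implyP.
rewrite inE => /and3P[u1 u2 uS].
apply: leq_trans (implyP (dS _) uS); rewrite /nbr_count.
rewrite (eq_in_count
  (a2 := [pred y in king_moves | torus_add u y \in periodic_set n S])).
  2: by move=> y yk /=; rewrite yk.
apply: sub_count => y /andP[/= yk]; rewrite inE => /and3P[y1 y2].
have /andP[s1 s2] : (y.1 \in steps) && (y.2 \in steps).
  move: yk; rewrite mem_filter => /andP[_ /allpairsP[z [z1 z2 ->]]].
  by rewrite z1 z2.
by rewrite /torus_add /= !wrap_cyc_add.
Qed.

(** The rows and columns below n - 1 hold a square array of disjoint full copies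
    of the torus of side N.+1, with (n - 1) / N.+1 copies on each side. *)
Lemma card_periodic_set (n N : nat) (S : {set 'I_N.+1 * 'I_N.+1}) :
  (((n.-1 %/ N.+1) ^ 2) * #|S| <= #|periodic_set n S|)%N.
Proof.
case: n => [|n]; first by rewrite div0n.
set q := (n %/ N.+1)%N; rewrite /= -/q.
pose D := finset.setX [set: 'I_q * 'I_q] S.
pose f (a : ('I_q * 'I_q) * ('I_N.+1 * 'I_N.+1)) : 'I_n.+1 * 'I_n.+1 :=
  (inord (a.1.1 * N.+1 + a.2.1), inord (a.1.2 * N.+1 + a.2.2)).
have lt (b : 'I_q) (i : 'I_N.+1) : (b * N.+1 + i < n)%N.
  have := leq_divM n N.+1; rewrite -/q; have := ltn_ord b; have := ltn_ord i.
  nia.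
have v (b : 'I_q) (i : 'I_N.+1) :
    (inord (b * N.+1 + i) : 'I_n.+1) = (b * N.+1 + i)%N :> nat.
  by rewrite inordK // ltnS ltnW.
have -> : (q ^ 2 * #|S| = #|D|)%N.
  by rewrite cardsX cardsT card_prod card_ord mulnn.
have finj : injective f.
  have inj1 (b c : 'I_q) (i j : 'I_N.+1) :
      (inord (b * N.+1 + i) : 'I_n.+1) = inord (c * N.+1 + j) -> b = c /\ i = j.
    move=> /(congr1 (@nat_of_ord _)); rewrite !v => e; split; apply: val_inj => /=.
      by have := congr1 (divn^~ N.+1) e; rewrite !divnMDl // !divn_small // !addn0.
    by have := congr1 (modn^~ N.+1) e; rewrite !modnMDl !modn_small.
  move=> [[b1 b2] [i1 i2]] [[c1 c2] [j1 j2]] [].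
  by move=> /inj1 [-> ->] /inj1 [-> ->].
rewrite -(card_imset _ finj).
apply/subset_leq_card/fintype.subsetP => _ /imsetP[a + ->].
rewrite !inE /= !v !ltnS !lt /=; case: a => [[b1 b2] [i1 i2]] /=.
have w (b : 'I_q) (i : 'I_N.+1) :
    wrap N (inord (b * N.+1 + i) : 'I_n.+1) = i.
  by apply: val_inj; rewrite /= wrapE v modnMDl modn_small.
by rewrite !w.
Qed.

(** Written without division. With q = (n - 1) / N, the copies of a
    maximum set cover a square of side q N >= n - N, and (n - N)^2 is at least
    n^2 - 2 N n. *)
Lemma kings_beta_compare (k n N : nat) :
  (kings_beta k N * n ^ 2 <= kings_beta k n * N ^ 2 + 2 * N ^ 3 * n)%N.
Proof.
case: N => [|N].
  have [S _ <-] := kings_beta_attained k 0.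
  by have := max_card (mem S); rewrite card_prod card_ord leqn0 => /eqP->.
have [S dS <-] := kings_beta_attained k N.+1.
have := kings_beta_max (periodic_set_dependent n dS).
have := card_periodic_set n S; set q := (_ %/ _)%N.
have := max_card (mem S); rewrite card_prod card_ord.
have : (n <= q * N.+1 + N.+1)%N.
  have := divn_eq n.-1 N.+1; rewrite -/q; have := ltn_pmod n.-1 (ltn0Sn N); lia.
move: (kings_beta k n) #|periodic_set n S| (#|S|) => b c s nq sN qs cb.
have n2 : (n ^ 2 <= (q * N.+1) ^ 2 + 2 * N.+1 * n)%N by nia.
apply: leq_trans (leq_mul (leqnn s) n2) _; rewrite mulnDr leq_add //.
  by rewrite expnMn mulnA leq_mul2r mulnC (leq_trans qs cb) orbT.
rewrite !mulnA leq_mul2r; apply/orP; right.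
by have := leq_mul sN (leqnn (2 * N.+1)); lia.
Qed.

Lemma kings_density_compare (R : realType) (k n N : nat) : (0 < n)%N ->
  kings_density R k N <= kings_density R k n + 2 * N%:R / n%:R.
Proof.
move=> n0; rewrite /kings_density; case: N => [|N].
  rewrite expr0n /= invr0 mulr0 mulr0 mul0r addr0.
  by rewrite divr_ge0 ?exprn_ge0 ?ler0n.
have nR : (0 : R) < n%:R by rewrite ltr0n.
have NR : (0 : R) < N.+1%:R by rewrite ltr0n.
have := kings_beta_compare k n N.+1.
rewrite -(ler_nat R) natrD !natrM => h.
rewrite ler_pdivrMr ?exprn_gt0 // -(ler_pM2r (exprn_gt0 2 nR)).
apply: le_trans h _; rewrite le_eqVlt; apply/orP; left; apply/eqP.
by field; rewrite gt_eqF.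
Qed.

Lemma has_sup_kings_density (R : realType) (k : nat) (c : R) :
  (forall n, kings_density R k n <= c) -> has_sup (range (kings_density R k)).
Proof.
move=> ub; split; first by exists (kings_density R k 0); exists 0%N.
by exists c => _ [n _ <-].
Qed.

(** If the density at N is within e / 2 of the supremum, so is, up to 2 N / n, the
    density at every n; and it never exceeds the supremum. *)
Lemma kings_density_cvg (R : realType) (k : nat) (c : R) :
  (forall n, kings_density R k n <= c) ->
  (kings_density R k @ \oo --> sup (range (kings_density R k)))%classic.
Proof.
move=> ub; set a := kings_density R k; set s := sup _.
have hs : has_sup (range a) := has_sup_kings_density ub.
apply/cvgrPdist_le => e e0.
have [_ [N _ <-] aN] := sup_adherent (divr_gt0 e0 (ltr0n R 2)) hs.
near=> n.
have n0 : (0 < n)%N by near: n; exists 1%N.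
have le_s : a n <= s by apply: sup_upper_bound => //; exists n.
have := kings_density_compare R k N n0; rewrite -/a => cmp.
have : 2 * N%:R / n%:R <= e / 2.
  rewrite ler_pdivrMr ?ltr0n // -ler_pdivrMl ?divr_gt0 //.
  by near: n; exact: nbhs_infty_ger.
rewrite ger0_norm ?subr_ge0 // -/s in aN *; lra.
Unshelve. all: by end_near.
Qed.

Lemma kings_tau_between (R : realType) (k N : nat) (c : R) :
  (forall n, kings_density R k n <= c) ->
  kings_density R k N <= kings_tau R k <= c.
Proof.
move=> ub; rewrite /kings_tau (cvg_lim _ (kings_density_cvg ub)) //.
apply/andP; split.
  by apply: (sup_upper_bound (has_sup_kings_density ub)); exists N.
apply: ge_sup; first by exists (kings_density R k 0); exists 0%N.
by move=> _ [n _ <-].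
Qed.

(** * Lattice patterns *)

Definition lattice_set (m c : nat) (A : seq nat) : {set 'I_m * 'I_m} :=
  [set u : 'I_m * 'I_m | (cyc_add u.1 (c%:Z * (u.2 : nat)%:Z) : nat) \in A].

Definition lattice_ok (k m c : nat) (A : seq nat) : bool :=
  all (fun r => (count (fun y : int * int =>
         absz ((r%:Z + (y.1 + c%:Z * y.2)) %% m%:Z)%Z \in A) king_moves <= k)%N) A.

(** A king move y changes the residue i + c j by y.1 + c y.2, so the number of
    neighbors of a point depends only on its residue, and lattice_ok inspects
    each residue once. *)
Lemma lattice_set_dependent (k m c : nat) (A : seq nat) :
  lattice_ok k m c A -> dependent_set k (lattice_set m c A).
Proof.
move=> /allP ok; apply/forallP => u; apply/implyP; rewrite inE => /ok.
apply: leq_trans; rewrite leq_eqVlt; apply/orP; left; apply/eqP.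
apply: eq_count => y; rewrite inE /=. congr (_ \in A); apply/eqP.
rewrite -eqz_nat cyc_addE !cyc_addE; apply/eqP.
set i := (u.1 : nat)%:Z; set j := (u.2 : nat)%:Z.
rewrite gez0_abs ?modz_ge0 //; last by case: (u.1) => ? /=; lia.
rewrite !modzDml -modzDmr modzMmr modzDmr; congr (_ %% _)%Z; lia.
Qed.

(** The shear (i, j) -> (i + c j, j) is injective and maps the set onto the rows
    in A. *)
Lemma card_lattice_set (m c : nat) (A : seq nat) :
  #|lattice_set m c A| = (count (mem A) (iota 0 m) * m)%N.
Proof.
pose f (u : 'I_m * 'I_m) := (cyc_add u.1 (c%:Z * (u.2 : nat)%:Z), u.2).
have finj : injective f.
  move=> [i j] [i' j'] [+ jj]; rewrite -jj.
  move=> /(congr1 (fun i => cyc_add i (- (c%:Z * (j : nat)%:Z)))).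
  by rewrite !cyc_addA subrr !cyc_add0 => ->.
have -> : lattice_set m c A =
    f @^-1: finset.setX [set i : 'I_m | (i : nat) \in A] [set: 'I_m].
  by apply/setP => u; rewrite !inE andbT.
rewrite on_card_preimset; last by apply/onW_bij/injF_bij.
rewrite cardsX cardsT card_ord; congr (_ * _)%N.
rewrite cardsE cardE /enum_mem size_filter -enumT -val_enum_ord.
by rewrite [RHS]count_map; apply: eq_count.
Qed.

Lemma lattice_density (R : realType) (k m c : nat) (A : seq nat) :
  lattice_ok k m c A ->
  (count (mem A) (iota 0 m))%:R / m%:R <= kings_density R k m.
Proof.
move=> ok; have := kings_beta_max (lattice_set_dependent ok).
rewrite card_lattice_set -(ler_nat R) natrM /kings_density.
case: m ok => [|m] _; first by rewrite invr0 !mulr0 expr0n invr0 mulr0.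
have mR : (0 : R) < m.+1%:R by rewrite ltr0n.
by move=> h; rewrite ler_pdivlMr ?exprn_gt0 // expr2 mulrA divfK ?gt_eqF.
Qed.

Lemma kings_density_le (R : realType) (k w B n : nat) (ex : seq exchange) :
  certificate_ok k w B ex -> (0 < w)%N ->
  kings_density R k n <= B%:R / (w * 16)%:R.
Proof.
move=> /(kings_beta_le n) + w0; rewrite -(ler_nat R) natrM [X in _ <= X]natrM natrX.
have wR : (0 : R) < (w * 16)%:R by rewrite ltr0n muln_gt0 w0.
case: n => [|n] h.
  by rewrite /kings_density expr0n invr0 mulr0 divr_ge0 ?ler0n.
by rewrite ler_pdivrMr ?exprn_gt0 ?ltr0n // mulrAC ler_pdivlMr // mulrC.
Qed.

(* The decimals 0.608956 and 0.693943 are split to keep the literals small. *)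
Theorem theorem4 (R : realType) :
  (3 / 5 <= kings_tau R 4 <= 608 / 10 ^+ 3 + 956 / 10 ^+ 6) /\
  (9 / 13 <= kings_tau R 5 <= 693 / 10 ^+ 3 + 943 / 10 ^+ 6).
Proof.
have ub4 n := kings_density_le R n certificate4_ok isT.
have ub5 n := kings_density_le R n certificate5_ok isT.
have /andP[l4 u4] := kings_tau_between 5 ub4.
have /andP[l5 u5] := kings_tau_between 13 ub5.
have lb4 : lattice_ok 4 5 2 [:: 0; 1; 2]%N by [].
have lb5 : lattice_ok 5 13 5 [:: 0; 1; 2; 3; 4; 5; 6; 8; 11]%N by [].
split; apply/andP; split.
- exact: le_trans (lattice_density R lb4) l4.
- apply: le_trans u4 _; lra.
- exact: le_trans (lattice_density R lb5) l5.
- apply: le_trans u5 _; lra.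
Qed.
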